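(* Let $p\ge 2$ be an even integer. Assume that $f\in S$ is even and non-negative. Then the function $t\mapsto N_t f=\|\widehat{S_t f}\|_{L^p(\mathbb{R})}$ decreases with $t$ on $[0,\infty)$. In particular, $N_t f\le N_0 f$ for all $t\ge 0$.
   Context: For $f\in L^1(\mathbb{R},\mathbb{R})\cap L^2(\mathbb{R},\mathbb{R})$ put $f_+(x)=f(x)\chi_{\{x>0\}}$ and $f_-(x)=f(x)\chi_{\{x<0\}}$. For $t\ge 0$ let $S_t f(x)=f_+(x-t)+f_-(x+t)$ (so $S_0f=f$ a.e.). The Fourier transform is $\hat f(y)=\int_{\mathbb{R}} e^{-2\pi i x y}f(x)\,dx$, and $N_t f=\|\widehat{S_t f}\|_p=\left(\int_{\mathbb{R}}|\widehat{S_tf}(y)|^p\,dy\right)^{1/p}$. The class $S$ is the set of real-valued $f\in L^1(\mathbb{R})\cap L^2(\mathbb{R})$ such that the convolution $f_+*f_-(x)=\int_{\mathbb{R}} f_+(y)f_-(x-y)\,dy$ is decreasing for $x\ge 0$. ''Decreasing'' means non-increasing (weakly decreasing). *)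

(* Defs.v *)
From mathcomp Require Import all_boot all_order all_algebra.
From mathcomp Require Import complex.
From mathcomp Require Import all_classical all_reals all_analysis.

Set Implicit Arguments.
Unset Strict Implicit.
Unset Printing Implicit Defensive.

Import Order.TTheory GRing.Theory Num.Theory.
Import numFieldNormedType.Exports.

Local Open Scope classical_set_scope.
Local Open Scope ring_scope.
Local Open Scope complex_scope.

Section definitions.
Context {R : realType}.
Implicit Types (f g : R -> R) (t x y : R).

Local Notation mu := (@lebesgue_measure R).

Definition right_part f : R -> R := fun x => f x * \1_[set u : R | 0 < u] x.

Definition left_part f : R -> R := fun x => f x * \1_[set u : R | u < 0] x.

Definition splitting t f : R -> R :=
  fun x => right_part f (x - t) + left_part f (x + t).

Definition convolution f g : R -> R :=
  fun x => \int[mu]_y (f y * g (x - y)).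

Definition Cexpi (theta : R) : R[i] := cos theta +i* sin theta.

(* MathComp-Analysis integrates only (extended) real-valued functions *)
Definition Cintegral (h : R -> R[i]) : R[i] :=
  (\int[mu]_x complex.Re (h x)) +i* (\int[mu]_x complex.Im (h x)).

Definition fourier f : R -> R[i] :=
  fun y => Cintegral (fun x => Cexpi (- (2 * pi * x * y)) * (f x)%:C).

(* [`|z|] has type [R[i]]; [normc z] is the same modulus as an element of [R] *)
Definition CLnorm (p : \bar R) (h : R -> R[i]) : \bar R :=
  Lnorm mu p (fun y => (ComplexField.Normc.normc (h y))%:E).

Definition split_norm (p : nat) t f : \bar R :=
  CLnorm (p%:R)%:E (fourier (splitting t f)).

(* Both factors of the convolution are square integrable, so its integrand is
   integrable for every x and its values do not depend on the representative
   of f: monotonicity can be stated pointwise *)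
Definition class_S f : Prop :=
  [/\ f \in Lfun mu 1%E, f \in Lfun mu 2%:E &
      forall x y, 0 <= x -> x <= y ->
        convolution (right_part f) (left_part f) y <=
        convolution (right_part f) (left_part f) x].

(* Elements of L^p are classes modulo equality almost everywhere, hence
   evenness and sign conditions are almost everywhere conditions *)
Definition ae_even f : Prop := {ae mu, forall x, f (- x) = f x}.

Definition ae_nonneg f : Prop := {ae mu, forall x, 0 <= f x}.

End definitions.

(* Main.v *)
From HB Require Import structures.
Require Import Defs.
From mathcomp Require Import all_boot all_order all_algebra.
From mathcomp Require Import complex ring lra.
From mathcomp Require Import all_classical all_reals all_analysis.
From mathcomp Require Import measurable_realfun.

Import Order.TTheory GRing.Theory Num.Theory.
Import numFieldNormedType.Exports.

Local Open Scope classical_set_scope.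
Local Open Scope ring_scope.

(** Put g = f_+. As f is even and non-negative, f_-(x) = g(-x) and g >= 0, so
    the Fourier transform of S_t f is real:
      D_t(y) = 2 \int cos(2 pi y (x + t)) g(x) dx,
    and p being even, |D_t|^p = D_t^p is a power to be expanded rather than an
    absolute value.

    To keep every integral absolutely convergent, D_t^p is integrated against
    the weight exp(-eps |y|), whose Fourier transform K, the Poisson kernel, is
    even, and decreasing on [0, +oo). By Fubini and the product formula for
    cosines, multiplying an integrand by D_t amounts to applying to its cosine
    transform the operator
      M_t phi(u) = A phi(u + t) + B phi(u - t),
    where A phi(u) = \int g(x) phi(u + x) dx averages phi to the right and
    B phi(u) = \int g(x) phi(u - x) dx averages it to the left. Hence
      \int exp(-eps |y|) D_t(y)^p dy = (M_t^p K)(0)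
    ([integral_weighted_power]).

    Expanding M_t^p gives terms (A^k B^l K)((k - l) t) with k + l = p, and each
    of them decreases with t. Indeed A and B commute, and AB is the convolution
    with the correlation h(v) = \int g(x) g(x + v) dx, that is with f_+ * f_-,
    which is symmetric and decreasing because f is in S. The convolution of
    two symmetric decreasing functions is again such
    ([sym_decreasing_convolution]), so for k >= l the function H = (AB)^l K is
    symmetric decreasing, and A^(k - l) H decreases on [0, +oo) because g lives
    on the right half-line; the case k < l is the mirror image. The binomial
    expansion itself is avoided: [iter_split_average_decr] runs an induction on
    the number of factors M_t, in which each factor either cancels an opposite
    average (producing an h) or adds one and moves the evaluation point along.

    Finally eps tends to 0 by monotone convergence ([integral_power_decr]).
    Square integrability of f makes h finite: this is what turns the hypothesis
    on f_+ * f_-, whose values are real numbers, into one on the integral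
    defining h, whose values are extended real numbers. *)

(** * Invariance of Lebesgue measure under x |-> e x + a with e = 1 or -1 *)

Section affine_invariance.
Context {R : realType}.
Local Notation mu := (@lebesgue_measure R).
Implicit Types (e a : R) (F : R -> \bar R).

Lemma measurable_affine e a : measurable_fun setT (fun x : R => e * x + a).
Proof. by apply: measurable_funD => //; exact: measurable_funM. Qed.

(** The condition [e ^+ 2 = 1] covers translations and reflections at once.
    Lebesgue measure is the only measure giving half-open intervals their
    length, and the pushforward has this property. *)
Lemma lebesgue_measure_affine e a (A : set R) : e ^+ 2 = 1 ->
  measurable A -> mu ((fun x => e * x + a) @^-1` A)%classic = mu A.
Proof.
move=> e1 mA.
pose phi (x : measurableTypeR R) : measurableTypeR R := e * x + a.
have mphi : measurable_fun setT phi by exact: measurable_affine.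
pose phi' : {mfun measurableTypeR R >-> measurableTypeR R} :=
  HB.pack phi (isMeasurableFun.Build _ _ _ _ _ mphi).
apply/esym; rewrite -[RHS]/(pushforward mu phi' A).
apply: lebesgue_measure_unique => //= _ [[c d] _ <-].
rewrite /pushforward /=.
have : e = 1 \/ e = -1.
  by move/eqP: e1; rewrite sqrf_eq1 => /orP[/eqP|/eqP]; [left|right].
case=> eE.
  rewrite (_ : _ @^-1` _ = `]c - a, d - a]%classic)%classic; last first.
    apply/seteqP; split => x /=; rewrite !in_itv/= /phi eE mul1r;
      by rewrite ltrBlDr lerBrDr.
  rewrite !lebesgue_measure_itv/= !lte_fin ltrD2r.
  by case: ifP => // _; rewrite -!EFinD; congr EFin; ring.
rewrite (_ : _ @^-1` _ = `[a - d, a - c[%classic)%classic; last first.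
  apply/seteqP; split => x /=; rewrite !in_itv/= /phi eE mulN1r;
    by move=> /andP[h1 h2]; apply/andP; split; lra.
rewrite !lebesgue_measure_itv/= !lte_fin ltrD2l ltrN2.
by case: ifP => // _; rewrite -!EFinD; congr EFin; ring.
Qed.

Lemma ge0_integral_affine e a F : e ^+ 2 = 1 ->
  measurable_fun setT F -> (forall x, 0 <= F x)%E ->
  (\int[mu]_x F (e * x + a)%R = \int[mu]_x F x)%E.
Proof.
move=> e1 mF F0.
pose phi (x : measurableTypeR R) : measurableTypeR R := e * x + a.
have mphi : measurable_fun setT phi by exact: measurable_affine.
pose phi' : {mfun measurableTypeR R >-> measurableTypeR R} :=
  HB.pack phi (isMeasurableFun.Build _ _ _ _ _ mphi).
transitivity (\int[pushforward mu phi']_x F x)%E.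
  by rewrite (@ge0_integral_pushforward _ _ _ _ _ phi).
by apply: eq_measure_integral => A mA _; exact: lebesgue_measure_affine.
Qed.

(** An extended integral is by definition the difference of those of the
    positive and negative parts, and each of these is invariant. *)
Lemma integral_affine e a F : e ^+ 2 = 1 -> measurable_fun setT F ->
  (\int[mu]_x F (e * x + a)%R = \int[mu]_x F x)%E.
Proof.
move=> e1 mF; rewrite integralE [RHS]integralE; congr (_ - _)%E.
  rewrite -[RHS](ge0_integral_affine e a)//; last exact: measurable_funepos.
  by apply: eq_integral => x _; rewrite !funeposE.
rewrite -[RHS](ge0_integral_affine e a)//; last exact: measurable_funeneg.
by apply: eq_integral => x _; rewrite !funenegE.
Qed.

Lemma integrable_affine e a F : e ^+ 2 = 1 -> mu.-integrable setT F ->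
  mu.-integrable setT (fun x => F (e * x + a)).
Proof.
move=> e1 /integrableP[mF iF]; apply/integrableP; split.
  by apply: measurableT_comp => //; exact: measurable_affine.
rewrite (ge0_integral_affine e a (fun x => `|F x|)%E)//.
exact: measurableT_comp.
Qed.

Lemma ae_affine e a (P : R -> Prop) : e ^+ 2 = 1 ->
  {ae mu, forall x, P x} -> {ae mu, forall x, P (e * x + a)}.
Proof.
move=> e1 [A [mA A0 PA]].
exists ((fun x => e * x + a) @^-1` A)%classic; split.
- by rewrite -[X in measurable X]setTI; exact: measurable_affine.
- by rewrite lebesgue_measure_affine.
- by move=> x /= nP; exact: PA.
Qed.

End affine_invariance.

(** * Symmetric decreasing functions *)

Section symmetric_decreasing.
Context {R : realType}.
Local Notation mu := (@lebesgue_measure R).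
Implicit Types (e a t : R) (phi psi h : R -> \bar R).

Definition nneg_measurable phi :=
  measurable_fun setT phi /\ forall x, (0 <= phi x)%E.

(** Comparing absolute values makes evenness part of the condition: equal
    absolute values force equal values. *)
Definition sym_decreasing phi :=
  forall x y, `|x| <= `|y| -> (phi y <= phi x)%E.

(** For reals this is [0 <= (a - b) * (c - d)]; it is stated for extended
    reals because iterated averages are integrals with values in [\bar R]. *)
Lemma rearrangement_ineq (a b c d : \bar R) : (0 <= b -> 0 <= d ->
  b <= a -> d <= c -> a * d + b * c <= a * c + b * d)%E.
Proof.
move=> b0 d0 ba dc.
have a0 : (0 <= a)%E by exact: le_trans ba.
have c0 : (0 <= c)%E by exact: le_trans dc.
have [a00|an0] := eqVneq a 0%E.
  have b00 : b = 0%E by apply/eqP; rewrite eq_le b0 -{1}a00 ba.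
  by rewrite a00 b00 !mul0e.
have [c00|cn0] := eqVneq c 0%E.
  have d00 : d = 0%E by apply/eqP; rewrite eq_le d0 -{1}c00 dc.
  by rewrite c00 d00 !mule0.
have ap : (0 < a)%E by rewrite lt0e an0.
have cp : (0 < c)%E by rewrite lt0e cn0.
have bd0 : (0 <= b * d)%E by exact: mule_ge0.
case: a a0 ba an0 ap => [a| |] a0 ba an0 ap //; last first.
  by rewrite (gt0_mulye cp) addye ?leey// -ltNye (lt_le_trans _ bd0)// ltNy0.
case: c c0 dc cn0 cp => [c| |] c0 dc cn0 cp //; last first.
  by rewrite (gt0_muley ap) addye ?leey// -ltNye (lt_le_trans _ bd0)// ltNy0.
case: b b0 ba bd0 => [b| |] // b0 ba bd0.
case: d d0 dc bd0 => [d| |] // d0 dc bd0.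
by rewrite -!EFinM -!EFinD !lee_fin in ba dc *; nra.
Qed.

Lemma lee_double (x y : \bar R) :
  (0 <= x -> 0 <= y -> x + x <= y + y -> x <= y)%E.
Proof.
case: y => [y| |]//; last by move=> *; exact: leey.
case: x => [x| |]// _ _; first by rewrite -!EFinD !lee_fin; lra.
Qed.

Lemma measurable_comp_affine phi e a : measurable_fun setT phi ->
  measurable_fun setT (fun x => phi (e * x + a)).
Proof. by move=> mphi; exact: measurableT_comp (measurable_affine e a). Qed.

(** The values at [a] and [b] are compared by centring both integrals at the
    midpoint [c] of [a] and [b]: with [d] half of [b - a] they become the
    integrals of [h (s - c) * phi (s - d)] and of [h (s - c) * phi (s + d)].
    Adding to each its image under [s -> - s] turns the integrands into the two
    sides of the rearrangement inequality. It holds pointwise since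
    [`|a| <= `|b|] makes [c * d] non-negative, so that [h (s - c)] and
    [phi (s - d)] are either both at least or both at most their values at
    [- s]. *)
Lemma sym_decreasing_convolution h phi :
  nneg_measurable h -> nneg_measurable phi ->
  sym_decreasing h -> sym_decreasing phi ->
  sym_decreasing (fun u => \int[mu]_v (h v * phi (u + v)%R))%E.
Proof.
move=> [mh h0] [mphi phi0] sh sphi a b ab.
pose c := (a + b) / 2; pose d := (b - a) / 2.
have cd0 : 0 <= c * d.
  have : a ^+ 2 <= b ^+ 2.
    rewrite -(real_normK (num_real a)) -(real_normK (num_real b)).
    by rewrite lerXn2r ?nnegrE.
  by rewrite /c /d !expr2; nra.
have m1 (k : R) : measurable_fun setT (fun s : R => h (s + k)).
  under eq_fun do rewrite -[X in h (X + _)]mul1r.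
  exact: measurable_comp_affine.
have m2 (k : R) : measurable_fun setT (fun s : R => phi (s + k)).
  under eq_fun do rewrite -[X in phi (X + _)]mul1r.
  exact: measurable_comp_affine.
have m12 (k l : R) :
    measurable_fun setT (fun s : R => h (s + k)%R * phi (s + l)%R)%E.
  exact: emeasurable_funM.
have p12 (k l s : R) : (0 <= h (s + k)%R * phi (s + l)%R)%E by exact: mule_ge0.
have evh x : h (- x) = h x by apply/eqP; rewrite eq_le !sh// normrN.
have evphi x : phi (- x) = phi x by apply/eqP; rewrite eq_le !sphi// normrN.
have E u k l : l = u + k ->
    (\int[mu]_v (h v * phi (u + v)%R) =
     \int[mu]_s (h (s + k)%R * phi (s + l)%R))%E.
  move=> ->; rewrite -[LHS](@ge0_integral_affine _ 1 k) ?expr1n//.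
  - by apply: eq_integral => s _; rewrite mul1r addrCA.
  - apply: emeasurable_funM => //.
    by under eq_fun do rewrite addrC; exact: m2.
  - by move=> x; rewrite mule_ge0.
have E' k l : (\int[mu]_s (h (s + k)%R * phi (s + l)%R) =
    \int[mu]_s (h (s + - k)%R * phi (s + - l)%R))%E.
  rewrite -[LHS](@ge0_integral_affine _ (-1) 0) ?sqrrN ?expr1n//.
  apply: eq_integral => s _; rewrite addr0 mulN1r.
  by rewrite -evh -evphi; congr (h _ * phi _)%E; rewrite opprD opprK.
have ia : (0 <= \int[mu]_v (h v * phi (a + v)%R))%E.
  by apply: integral_ge0 => v _; exact: mule_ge0.
have ib : (0 <= \int[mu]_v (h v * phi (b + v)%R))%E.
  by apply: integral_ge0 => v _; exact: mule_ge0.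
apply: lee_double => //.
rewrite {1}(E b (- c) d); last by rewrite /c /d; field.
rewrite {1}(E b (- c) d); last by rewrite /c /d; field.
rewrite {1}(E a (- c) (- d)); last by rewrite /c /d; field.
rewrite {1}(E a (- c) (- d)); last by rewrite /c /d; field.
(* one of the two copies on each side is reflected, then they are added *)
rewrite {2}(E' (- c) d) {2}(E' (- c) (- d)) !opprK -!ge0_integralD//;
  try exact: m12.
apply: ge0_le_integral => //.
- by move=> s _; apply: adde_ge0; exact: p12.
- by apply: emeasurable_funD; exact: m12.
- by apply: emeasurable_funD; exact: m12.
- move=> s _.
  have key (k l : R) : 0 <= k * l -> `|k + - l| <= `|k + l|.
    move=> kl; rewrite -(@ler_pXn2r _ 2) ?nnegrE// !real_normK ?num_real//.
    by nra.
  have key' (k l : R) : k * l <= 0 -> `|k + l| <= `|k + - l|.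
    move=> kl; rewrite -(@ler_pXn2r _ 2) ?nnegrE// !real_normK ?num_real//.
    by nra.
  have [[sc sd]|[sc sd]] :
      (0 <= s * c /\ 0 <= s * d) \/ (s * c <= 0 /\ s * d <= 0).
    have : 0 <= (s * c) * (s * d) by rewrite mulrACA mulr_ge0// -expr2 sqr_ge0.
    move: (s * c) (s * d) => p q pq.
    have [p0|p0|p0] := ltrgtP p 0; [right; split; nra|left; split; nra|].
    by have [q0|q0] := leP 0 q; [left|right]; split; lra.
  - by apply: rearrangement_ineq => //; [apply: sh|apply: sphi]; exact: key.
  - rewrite addeC [leRHS]addeC; apply: rearrangement_ineq => //;
      by [apply: sh; exact: key'|apply: sphi; exact: key'].
Qed.

End symmetric_decreasing.

(** * Averages to the right and to the left *)

Section one_sided_averages.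
Context {R : realType}.
Local Notation mu := (@lebesgue_measure R).
Implicit Types (e a t : R) (phi psi : R -> \bar R).
Variable g : R -> R.
Hypotheses (mg : measurable_fun setT g) (g_ge0 : forall x, 0 <= g x).

(** For [g] supported on the right half-line, [average 1] averages over the
    points to the right of [u], and [average (-1)] over those to its left. *)
Definition average e phi : R -> \bar R :=
  fun u => (\int[mu]_x ((g x)%:E * phi (u + e * x)%R))%E.

(** This is the convolution of [g] with its reflection. *)
Definition correlation : R -> \bar R :=
  fun v => (\int[mu]_x (g x * g (x + v))%:E)%E.

Lemma average_integrand_ge0 e phi u x : nneg_measurable phi ->
  (0 <= (g x)%:E * phi (u + e * x)%R)%E.
Proof. by move=> [_ phi0]; rewrite mule_ge0// lee_fin. Qed.

Lemma measurable_average_integrand e phi : nneg_measurable phi ->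
  measurable_fun setT
    (fun z : R * R => ((g z.2)%:E * phi (z.1 + e * z.2)%R)%E).
Proof.
move=> [mphi _]; apply: emeasurable_funM.
  by apply: measurableT_comp => //; exact: measurableT_comp.
apply: measurableT_comp => //; apply: measurable_funD => //.
exact: measurable_funM.
Qed.

Lemma measurable_average_integrand1 e phi u : nneg_measurable phi ->
  measurable_fun setT (fun x => ((g x)%:E * phi (u + e * x)%R)%E).
Proof.
move=> nphi.
exact: (measurable_fun_pair2 u (measurable_average_integrand e phi nphi)).
Qed.

Lemma nneg_measurable_average e phi :
  nneg_measurable phi -> nneg_measurable (average e phi).
Proof.
move=> nphi; split; last first.
  by move=> u; apply: integral_ge0 => x _; exact: average_integrand_ge0.
apply: (@measurable_fun_fubini_tonelli_F _ _ _ _ _ mu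
  (fun z : R * R => ((g z.2)%:E * phi (z.1 + e * z.2)%R)%E)).
- exact: measurable_average_integrand.
- by move=> z; exact: average_integrand_ge0.
Qed.

Lemma nneg_measurableD phi psi : nneg_measurable phi -> nneg_measurable psi ->
  nneg_measurable (fun u => phi u + psi u)%E.
Proof.
move=> [mphi phi0] [mpsi psi0]; split; first exact: emeasurable_funD.
by move=> x; exact: adde_ge0.
Qed.

Lemma nneg_measurable_shift phi a : nneg_measurable phi ->
  nneg_measurable (fun u => phi (u + a)).
Proof.
move=> [mphi phi0]; split => //.
under eq_fun do rewrite -[X in phi (X + _)]mul1r.
exact: measurable_comp_affine.
Qed.

Lemma nneg_measurable_correlation : nneg_measurable correlation.
Proof.
split; last by move=> v; apply: integral_ge0 => x _; rewrite lee_fin mulr_ge0.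
apply: (@measurable_fun_fubini_tonelli_F _ _ _ _ _ mu
  (fun z : R * R => ((g z.2) * g (z.2 + z.1))%:E)).
- apply/measurable_EFinP; apply: measurable_funM; first exact: measurableT_comp.
  by apply: measurableT_comp => //; exact: measurable_funD.
- by move=> z; rewrite lee_fin mulr_ge0.
Qed.

Lemma averageD e phi psi : nneg_measurable phi -> nneg_measurable psi ->
  average e (fun u => phi u + psi u)%E =
  (fun u => average e phi u + average e psi u)%E.
Proof.
move=> nphi npsi; apply/funext => u; rewrite /average -ge0_integralD//.
- by apply: eq_integral => x _; rewrite ge0_muleDr ?(proj2 nphi) ?(proj2 npsi).
- by move=> x _; exact: average_integrand_ge0.
- exact: measurable_average_integrand1.
- by move=> x _; exact: average_integrand_ge0.
- exact: measurable_average_integrand1.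
Qed.

Lemma average_shift e phi a :
  average e (fun u => phi (u + a)) = (fun u => average e phi (u + a)).
Proof.
apply/funext => u; apply: eq_integral => x _.
by congr (_ * phi _)%E; rewrite addrAC.
Qed.

Lemma averageC a b phi : nneg_measurable phi ->
  average a (average b phi) = average b (average a phi).
Proof.
move=> nphi; apply/funext => u.
have Z c d : average c (average d phi) u =
    (\int[mu]_x \int[mu]_z
       ((g x)%:E * ((g z)%:E * phi (u + c * x + d * z)%R)))%E.
  apply: eq_integral => x _; rewrite -ge0_integralZl//.
  - exact: measurable_average_integrand1.
  - by move=> z _; exact: average_integrand_ge0.
  - by rewrite lee_fin.
rewrite !Z.
rewrite (@fubini_tonelli _ _ _ _ _ mu mu
  (fun z : R * R =>
     ((g z.1)%:E * ((g z.2)%:E * phi (u + a * z.1 + b * z.2)%R))%E)).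
- apply: eq_integral => x _; apply: eq_integral => z _ /=.
  by rewrite muleCA addrAC.
- apply: emeasurable_funM.
    by apply: measurableT_comp => //; exact: measurableT_comp.
  apply: emeasurable_funM.
    by apply: measurableT_comp => //; exact: measurableT_comp.
  apply: measurableT_comp; first exact: (proj1 nphi).
  apply: measurable_funD; last exact: measurable_funM.
  by apply: measurable_funD => //; exact: measurable_funM.
- by move=> z; rewrite mule_ge0 ?lee_fin//; exact: average_integrand_ge0.
Qed.

(** The displacements of the two opposite averages partly cancel: grouping them
    by their difference [v] collects exactly the mass [correlation v]. Here the
    half-line disappears, and symmetry can be used. *)
Lemma average_opposite e phi : e = 1 \/ e = -1 -> nneg_measurable phi ->
  average (- e) (average e phi) =
  (fun u => \int[mu]_v (correlation v * phi (u + v)%R))%E.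
Proof.
move=> e1 nphi.
wlog -> : e e1 / e = 1.
  move=> H; case: e1 => eE; first by apply: H; [left|].
  rewrite averageC// -{1}(opprK e).
  by apply: (H (- e)); rewrite eE opprK//; left.
apply/funext => u.
transitivity (\int[mu]_x \int[mu]_v
    ((g x)%:E * ((g (x + v))%:E * phi (u + v)%R)))%E.
  apply: eq_integral => x _; rewrite -ge0_integralZl ?lee_fin//; last 2 first.
  - exact: measurable_average_integrand1.
  - by move=> z _; exact: average_integrand_ge0.
  rewrite -[LHS](@ge0_integral_affine _ 1 x) ?expr1n//.
  - apply: eq_integral => v _; rewrite mul1r addrC.
    by congr (_ * (_ * phi _))%E; ring.
  - by apply: emeasurable_funM => //; exact: measurable_average_integrand1.
  - by move=> v; rewrite mule_ge0 ?lee_fin//; exact: average_integrand_ge0.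
rewrite (@fubini_tonelli _ _ _ _ _ mu mu
  (fun z : R * R =>
     ((g z.1)%:E * ((g (z.1 + z.2))%:E * phi (u + z.2)%R))%E)).
- apply: eq_integral => v _ /=.
  rewrite /fubini_G /correlation -ge0_integralZr//.
  + by apply: eq_integral => x _; rewrite muleA.
  + apply/measurable_EFinP; apply: measurable_funM => //.
    by apply: measurableT_comp => //; exact: measurable_funD.
  + by move=> x _; rewrite lee_fin mulr_ge0.
  + exact: (proj2 nphi).
- apply: emeasurable_funM.
    by apply: measurableT_comp => //; exact: measurableT_comp.
  apply: emeasurable_funM.
    apply: measurableT_comp => //; apply: measurableT_comp => //.
    exact: measurable_funD.
  apply: measurableT_comp; first exact: (proj1 nphi).
  exact: measurable_funD.
- by move=> z; rewrite !mule_ge0 ?lee_fin//; exact: (proj2 nphi).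
Qed.

End one_sided_averages.

(** * Monotonicity in t of the iterated operator *)

Section monotonicity.
Context {R : realType}.
Implicit Types (e a s t : R) (phi psi H : R -> \bar R).
Variable g : R -> R.
Hypotheses (mg : measurable_fun setT g) (g_ge0 : forall x, 0 <= g x).
Hypothesis g_pos : forall x, x <= 0 -> g x = 0.
Hypothesis correlation_decr : sym_decreasing (correlation g).

Local Notation avg := (average g).

(** On cosine transforms, this is multiplication of the integrand by the Fourier
    transform of S_t f: see [integral_cos_transform_split]. *)
Definition split_average t phi : R -> \bar R :=
  fun u => (avg 1 phi (u + t)%R + avg (-1) phi (u - t)%R)%E.

Lemma nneg_measurable_iter (op : (R -> \bar R) -> R -> \bar R) n phi :
  (forall psi, nneg_measurable psi -> nneg_measurable (op psi)) ->
  nneg_measurable phi -> nneg_measurable (iter n op phi).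
Proof. by move=> nop nphi; elim: n => //= n IH; exact: nop. Qed.

Lemma nneg_measurable_split_average t phi :
  nneg_measurable phi -> nneg_measurable (split_average t phi).
Proof.
move=> nphi; apply: nneg_measurableD; apply: nneg_measurable_shift;
  exact: nneg_measurable_average.
Qed.

Lemma split_averageD t phi psi : nneg_measurable phi -> nneg_measurable psi ->
  split_average t (fun u => phi u + psi u)%E =
  (fun u => split_average t phi u + split_average t psi u)%E.
Proof.
move=> nphi npsi; apply/funext => u.
by rewrite /split_average !averageD// addeACA.
Qed.

Lemma iter_split_averageD t n phi psi :
  nneg_measurable phi -> nneg_measurable psi ->
  iter n (split_average t) (fun u => phi u + psi u)%E =
  (fun u => iter n (split_average t) phi u + iter n (split_average t) psi u)%E.
Proof.
move=> nphi npsi; elim: n => //= n ->; rewrite split_averageD//;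
  apply: nneg_measurable_iter => // ? ?;
  exact: nneg_measurable_split_average.
Qed.

Lemma iter_split_average_shift t n phi a :
  iter n (split_average t) (fun u => phi (u + a)) =
  (fun u => iter n (split_average t) phi (u + a)).
Proof.
elim: n => //= n ->; apply/funext => u.
rewrite /split_average !average_shift.
by congr (average _ _ _ _ + average _ _ _ _)%E; rewrite addrAC.
Qed.

(** Unfolding the innermost factor; with [e] or [- e] listed first, according to
    the direction in which [phi] is already averaged. *)
Lemma iter_split_averageS t n phi e u : e = 1 \/ e = -1 ->
  nneg_measurable phi ->
  iter n.+1 (split_average t) phi u =
  (iter n (split_average t) (avg e phi) (u + e * t)%R +
   iter n (split_average t) (avg (- e) phi) (u - e * t)%R)%E.
Proof.
move=> e1 nphi.
have nav a : nneg_measurable (avg a phi) by exact: nneg_measurable_average.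
rewrite iterSr {2}/split_average iter_split_averageD; last 2 first.
- exact: nneg_measurable_shift.
- exact: nneg_measurable_shift.
rewrite (iter_split_average_shift t n _ t).
rewrite (iter_split_average_shift t n _ (- t)).
by case: e1 => ->; rewrite ?opprK ?mul1r ?mulN1r ?opprK// addeC.
Qed.

(** Only points farther along the ray are averaged, since [g] vanishes on the
    negative half-line. *)
Lemma average_decr_ray e phi : e ^+ 2 = 1 -> nneg_measurable phi ->
  (forall x y, 0 <= x -> x <= y -> (phi (e * y)%R <= phi (e * x)%R)%E) ->
  forall x y, 0 <= x -> x <= y ->
  (avg e phi (e * y)%R <= avg e phi (e * x)%R)%E.
Proof.
move=> e1 nphi dphi x y x0 xy; apply: ge0_le_integral => //.
- by move=> z _; exact: average_integrand_ge0.
- exact: measurable_average_integrand1.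
- exact: measurable_average_integrand1.
move=> z _; have [z0|z0] := leP z 0; first by rewrite g_pos// !mul0e.
rewrite -!mulrDr lee_wpmul2l ?lee_fin//; apply: dphi; last exact: lerD.
by rewrite addr_ge0// ltW.
Qed.

Lemma iter_averageC a b n phi : nneg_measurable phi ->
  avg a (iter n (avg b) phi) = iter n (avg b) (avg a phi).
Proof.
move=> nphi; elim: n => //= n <-; rewrite averageC//.
by apply: nneg_measurable_iter => // ? ?; exact: nneg_measurable_average.
Qed.

(** The function [iter j (avg e) H] with [H] symmetric decreasing, evaluated at
    [e * (j%:R * t)], is a term in which [j] more averages go in direction [e]
    than in the opposite one. Each further factor [split_average t] turns it
    into two terms of the same form, with [j + 1] and [j - 1] (for [j = 0], the
    value [- 1] means [1] in direction [- e]). In the second, the average that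
    is cancelled joins with its opposite to replace [H] by the convolution of
    [correlation g] with [H], which is symmetric decreasing as well. *)
Lemma iter_split_average_decr n e j H : e = 1 \/ e = -1 ->
  nneg_measurable H -> sym_decreasing H ->
  forall s t, 0 <= s -> s <= t ->
  (iter n (split_average t) (iter j (avg e) H) (e * (j%:R * t))%R <=
   iter n (split_average s) (iter j (avg e) H) (e * (j%:R * s))%R)%E.
Proof.
have nav a phi : nneg_measurable phi -> nneg_measurable (avg a phi).
  exact: nneg_measurable_average.
have sq c : c = 1 \/ c = -1 :> R -> c ^+ 2 = 1.
  by case=> ->; rewrite ?sqrrN expr1n.
move=> + + + s t s0 st; elim: n e j H => [|n IH] e j H e1 nH sH.
  have D : forall x y, 0 <= x -> x <= y ->
      (iter j (avg e) H (e * y)%R <= iter j (avg e) H (e * x)%R)%E.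
    elim: j => [|j IHj] /=.
      move=> x y x0 xy; apply: sH; rewrite !normrM ler_wpM2l//.
      by rewrite !ger0_norm// (le_trans x0).
    apply: average_decr_ray => //; first exact: sq.
    by apply: nneg_measurable_iter => // ?; exact: nav.
  by apply: D; [rewrite mulr_ge0|rewrite ler_wpM2l].
have nj : nneg_measurable (iter j (avg e) H).
  by apply: nneg_measurable_iter => // ?; exact: nav.
rewrite !(iter_split_averageS _ n _ e)//; apply: leeD.
  have E r : e * (j%:R * r) + e * r = e * (j.+1%:R * r).
    by rewrite -natr1; ring.
  by rewrite !E -!iterS; exact: IH.
case: j nj => [|j] nj /=.
  rewrite !mul0r !mulr0 !add0r.
  have E r : - (e * r) = (- e) * (1%:R * r) by rewrite mul1r mulNr.
  rewrite !E; apply: (IH (- e) 1%N) => //.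
  by case: e1 => ->; [right|left; rewrite opprK].
have E r : e * (j.+1%:R * r) - e * r = e * (j%:R * r).
  by rewrite -natr1; ring.
rewrite !E -iterS iterSr iter_averageC; last exact: nav.
apply: IH => //; first exact/nav/nav.
rewrite average_opposite//; apply: sym_decreasing_convolution => //.
exact: nneg_measurable_correlation.
Qed.

End monotonicity.

(** * The exponential weight and its cosine transform *)

Section exponential_weight.
Context {R : realType}.
Local Notation mu := (@lebesgue_measure R).
Implicit Types (b u x y : R).
Variable eps : R.
Hypothesis eps_gt0 : 0 < eps.

Definition exp_weight y : R := expR (- (eps * `|y|)).

Lemma exp_weight_ge0 y : 0 <= exp_weight y.
Proof. exact: expR_ge0. Qed.

Lemma exp_weightN y : exp_weight (- y) = exp_weight y.
Proof. by rewrite /exp_weight normrN. Qed.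

Lemma continuous_cosM b : continuous (fun y : R => cos (b * y)).
Proof.
move=> y; apply: continuous_comp; last exact: continuous_cos.
exact: mulrl_continuous.
Qed.

Lemma continuous_exp_weight : continuous exp_weight.
Proof.
move=> y; apply: (@continuous_comp _ _ _ (fun y : R => - (eps * `|y|)) expR);
  last exact: continuous_expR.
apply: continuousN; apply: continuousM; first exact: cvg_cst.
exact: norm_continuous.
Qed.

Definition exp_cos_primitive b y : R :=
  expR (- (eps * y)) *
    (- eps^-1 + (b * sin (b * y) - eps * cos (b * y)) / (eps ^+ 2 + b ^+ 2)).

Lemma is_derive_exp_cos_primitive b y : is_derive y 1 (exp_cos_primitive b)
  (expR (- (eps * y)) * (1 + cos (b * y))).
Proof.
have d0 : eps ^+ 2 + b ^+ 2 != 0.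
  by rewrite gt_eqF// ltr_wpDr ?sqr_ge0 ?exprn_gt0.
rewrite /exp_cos_primitive.
apply: is_derive_eq.
rewrite /GRing.scale/=; field.
by rewrite d0 gt_eqF.
Qed.

Lemma cvg_exp_cos_primitive b :
  exp_cos_primitive b y @[y --> +oo%R] --> (0 : R).
Proof.
pose C := eps^-1 + (`|b| + eps) / (eps ^+ 2 + b ^+ 2).
have d0 : 0 < eps ^+ 2 + b ^+ 2 by rewrite ltr_wpDr ?sqr_ge0 ?exprn_gt0.
have expC : expR (- (eps * y)) * C @[y --> +oo%R] --> (0 : R).
  rewrite -[X in _ --> X](mul0r C); apply: cvgM; last exact: cvg_cst.
  apply: (@cvg_comp _ _ _ (fun y : R => eps * y) (fun y => expR (- y)) _
    (pinfty_nbhs R)).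
    exact: gt0_cvgMry.
  exact: cvgr_expR.
have bnd y : `|exp_cos_primitive b y| <= expR (- (eps * y)) * C.
  rewrite /exp_cos_primitive normrM ger0_norm ?expR_ge0// ler_wpM2l ?expR_ge0//.
  apply: (le_trans (ler_normD _ _)).
  rewrite normrN gtr0_norm ?invr_gt0// lerD2l.
  rewrite normrM (gtr0_norm (_ : 0 < _^-1)) ?invr_gt0//.
  rewrite ler_wpM2r ?invr_ge0 ?(ltW d0)//.
  apply: (le_trans (ler_normB _ _)); rewrite !normrM (gtr0_norm eps_gt0).
  rewrite lerD// ler_piMr ?(ltW eps_gt0)// ler_norml ?sin_geN1 ?sin_le1//.
  by rewrite cos_geN1 cos_le1.
have expCN : - (expR (- (eps * y)) * C) @[y --> +oo%R] --> (0 : R).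
  by rewrite -oppr0; exact: cvgN.
apply: squeeze_cvgr expCN expC.
by near=> y; rewrite -ler_norml.
Unshelve. all: by end_near. Qed.

(** Adding 1 to the cosine makes the integrand non-negative, so that the
    improper integral can be evaluated before integrability is known; [b = 0]
    then gives integrability of the weight, and the 1 is subtracted again in
    [integral_exp_weight_cos]. *)
Lemma integral_exp_weight_1cos b :
  (\int[mu]_y (exp_weight y * (1 + cos (b * y)))%:E =
   (2 / eps + 2 * eps / (eps ^+ 2 + b ^+ 2))%:E)%E.
Proof.
rewrite ge0_symfun_integralT; last 3 first.
- by move=> y; rewrite mulr_ge0 ?exp_weight_ge0// -lerBlDl sub0r cos_geN1.
- move=> y; apply: continuousM; first exact: continuous_exp_weight.
  by apply: continuousD; [exact: cvg_cst|exact: continuous_cosM].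
- by move=> y /=; rewrite exp_weightN mulrN cosN.
rewrite -set_itvcy.
under eq_integral.
  move=> y; rewrite inE/= in_itv/= andbT => y0.
  rewrite /exp_weight ger0_norm//; over.
rewrite (@ge0_continuous_FTC2y _ _ (exp_cos_primitive b) 0 0).
- rewrite /exp_cos_primitive !mulr0 oppr0 expR0 sin0 cos0 -EFinB -EFinM.
  congr EFin; field.
  by rewrite !gt_eqF// ltr_wpDr ?sqr_ge0 ?exprn_gt0.
- by move=> y y0; rewrite mulr_ge0 ?expR_ge0// -lerBlDl sub0r cos_geN1.
- apply: continuous_subspaceT.
  have : continuous (fun y : R => expR (- (eps * y)) * (1 + cos (b * y))).
    by move=> y; apply/differentiable_continuous/derivable1_diffP.
  exact.
- exact: cvg_exp_cos_primitive.
- by move=> y _; have [] := is_derive_exp_cos_primitive b y.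
- apply: cvg_at_right_filter.
  apply: differentiable_continuous; apply/derivable1_diffP.
  by have [] := is_derive_exp_cos_primitive b 0.
- by move=> y _; rewrite derive1E; have [_] := is_derive_exp_cos_primitive b y.
Qed.

Let measurable_weight : measurable_fun setT exp_weight.
Proof. exact: continuous_measurable_fun continuous_exp_weight. Qed.

Lemma integrable_exp_weight : mu.-integrable setT (EFin \o exp_weight).
Proof.
apply/integrableP; split; first exact/measurable_EFinP.
apply: (@le_lt_trans _ _ (\int[mu]_y (exp_weight y * (1 + cos (0 * y)))%:E)%E).
  apply: ge0_le_integral => //.
  - by do 2 apply: measurableT_comp => //.
  - apply/measurable_EFinP; apply: measurable_funM => //.
    apply: measurable_funD => //.
    exact: continuous_measurable_fun (continuous_cosM 0).
  - move=> y _ /=; rewrite lee_fin ger0_norm ?exp_weight_ge0//.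
    by rewrite mul0r cos0 ler_peMr ?exp_weight_ge0// lerDl.
by rewrite integral_exp_weight_1cos ltry.
Qed.

Lemma integrable_exp_weight_cos b :
  mu.-integrable setT (fun y => (exp_weight y * cos (b * y))%:E).
Proof.
apply: le_integrable integrable_exp_weight => //.
  apply/measurable_EFinP; apply: measurable_funM => //.
  exact: continuous_measurable_fun (continuous_cosM b).
move=> y _ /=; rewrite lee_fin normrM ler_piMr// ler_norml.
by rewrite cos_geN1 cos_le1.
Qed.

Lemma integral_exp_weight_cos b :
  (\int[mu]_y (exp_weight y * cos (b * y))%:E =
   (2 * eps / (eps ^+ 2 + b ^+ 2))%:E)%E.
Proof.
have I c : (\int[mu]_y (exp_weight y)%:E +
            \int[mu]_y (exp_weight y * cos (c * y))%:E =
            (2 / eps + 2 * eps / (eps ^+ 2 + c ^+ 2))%:E)%E.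
  rewrite -integral_exp_weight_1cos -integralD//.
  - by apply: eq_integral => y _; rewrite -EFinD mulrDr mulr1.
  - exact: integrable_exp_weight.
  - exact: integrable_exp_weight_cos.
have I0 : (\int[mu]_y (exp_weight y)%:E = (2 / eps)%:E)%E.
  have := I 0.
  under [X in (_ + X)%E = _ -> _]eq_integral do rewrite mul0r cos0 mulr1.
  have /fineK <- := integrable_fin_num measurableT integrable_exp_weight.
  rewrite -EFinD => -[] E; congr EFin.
  have : eps != 0 by rewrite gt_eqF.
  move: E; rewrite expr0n addr0 expr2 => + e0.
  have -> : 2 * eps / (eps * eps) = 2 / eps by field.
  by lra.
have := I b; rewrite I0.
have /fineK <- := integrable_fin_num measurableT (integrable_exp_weight_cos b).
by rewrite -!EFinD => -[] /addrI ->.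
Qed.

(** Up to normalisation, the Poisson kernel of the upper half-plane. *)
Definition exp_kernel u : \bar R :=
  (2 * eps / (eps ^+ 2 + (2 * pi * u) ^+ 2))%:E.

Lemma sym_decreasing_exp_kernel :
  sym_decreasing exp_kernel.
Proof.
move=> x y xy; rewrite lee_fin ler_wpM2l ?mulr_ge0 ?(ltW eps_gt0)//.
have d0 u : 0 < eps ^+ 2 + (2 * pi * u) ^+ 2.
  by rewrite ltr_wpDr ?sqr_ge0 ?exprn_gt0.
rewrite lef_pV2 ?posrE// lerD2l.
rewrite -(real_normK (num_real (2 * pi * x))).
rewrite -(real_normK (num_real (2 * pi * y))).
by rewrite lerXn2r ?nnegrE// !normrM ler_wpM2l.
Qed.

Lemma nneg_measurable_exp_kernel :
  nneg_measurable exp_kernel.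
Proof.
have d0 (u : R) : 0 < eps ^+ 2 + (2 * pi * u) ^+ 2.
  by rewrite ltr_wpDr ?sqr_ge0 ?exprn_gt0.
split; last first.
  move=> u.
  by rewrite lee_fin divr_ge0 ?mulr_ge0 ?(ltW (d0 _)) ?(ltW eps_gt0).
apply/measurable_EFinP/measurable_funM => //.
have : continuous (fun u : R => (eps ^+ 2 + (2 * pi * u) ^+ 2)^-1).
  move=> u.
  apply: (@continuousV R _ (fun u : R => eps ^+ 2 + (2 * pi * u) ^+ 2)).
    by rewrite gt_eqF.
  by apply/differentiable_continuous/derivable1_diffP.
exact: continuous_measurable_fun.
Qed.

End exponential_weight.

(** * Powers of the transform as iterated averages *)

Section fourier_side.
Context {R : realType}.
Local Notation mu := (@lebesgue_measure R).
Implicit Types (b u t x y : R) (v : R -> R).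
Variable g : R -> R.
Hypotheses (mg : measurable_fun setT g) (g_ge0 : forall x, 0 <= g x).
Hypothesis ig : mu.-integrable setT (EFin \o g).

Lemma measurable_cos_comp d (T : measurableType d) (h : T -> R) :
  measurable_fun setT h -> measurable_fun setT (fun z => cos (h z)).
Proof.
exact: (measurableT_comp (continuous_measurable_fun (@continuous_cos R))).
Qed.

Lemma normr_cos_le1 x : `|cos x| <= 1.
Proof. by rewrite ler_norml cos_geN1 cos_le1. Qed.

Lemma integrable_bounded_tensor v (k : R * R -> R) (B : R) :
  mu.-integrable setT (EFin \o v) ->
  measurable_fun setT k -> (forall z, `|k z| <= B) ->
  (mu \x mu)%E.-integrable setT (fun z : R * R => (v z.1 * g z.2 * k z)%:E).
Proof.
move=> iv mk kB.
have mv : measurable_fun setT v.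
  by apply/measurable_EFinP; exact: measurable_int iv.
have mvg : measurable_fun setT (fun z : R * R => v z.1 * g z.2).
  by apply: measurable_funM; exact: measurableT_comp.
have B0 : 0 <= B by exact: le_trans (kB (0, 0)).
have ivg : (mu \x mu)%E.-integrable setT (fun z : R * R => (v z.1 * g z.2)%:E).
  apply/integrable12ltyP; first exact/measurable_EFinP.
  have mgE : measurable_fun setT (EFin \o g) by exact/measurable_EFinP.
  rewrite [X in (X < _)%E](_ : _ =
      \int[mu]_y (`|v y|%:E * \int[mu]_x (g x)%:E))%E; last first.
    apply: eq_integral => y _ /=.
    rewrite -ge0_integralZl ?lee_fin//; last first.
      by move=> x _; rewrite lee_fin.
    by apply: eq_integral => x _; rewrite normrM (ger0_norm (g_ge0 x)) EFinM.
  rewrite ge0_integralZr//; last 2 first.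
  - by do 2 apply: measurableT_comp => //.
  - by apply: integral_ge0 => x _; rewrite lee_fin.
  have /integrableP[_ lv] := iv; have /integrableP[_ lg] := ig.
  rewrite lte_mul_pinfty//; first exact: integral_ge0.
    by rewrite ge0_fin_numE//; exact: integral_ge0.
  by under eq_integral do rewrite -(ger0_norm (g_ge0 _)).
apply: le_integrable (integrableZl measurableT B ivg) => //.
  by apply/measurable_EFinP; exact: measurable_funM.
move=> z _ /=; rewrite lee_fin normrM mulrC [leRHS]normrM (ger0_norm B0).
by rewrite ler_wpM2r.
Qed.

Definition cos_transform t y : R :=
  \int[mu]_x (cos (2 * pi * y * (x + t)) * g x).

Lemma measurable_cos_kernel t :
  measurable_fun setT (fun z : R * R => cos (2 * pi * z.1 * (z.2 + t))).
Proof.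
apply: measurable_cos_comp; apply: measurable_funM.
  exact: measurable_funM.
exact: measurable_funD.
Qed.

Lemma integrable_cos_kernel t y :
  mu.-integrable setT (fun x => (cos (2 * pi * y * (x + t)) * g x)%:E).
Proof.
apply: le_integrable ig => //.
  apply/measurable_EFinP; apply: measurable_funM => //.
  exact: (measurable_fun_pair2 y (measurable_cos_kernel t)).
by move=> x _ /=; rewrite lee_fin normrM ler_piMl// normr_cos_le1.
Qed.

Lemma EFin_cos_transform t y :
  ((cos_transform t y)%:E = \int[mu]_x (cos (2 * pi * y * (x + t)) * g x)%:E)%E.
Proof.
rewrite fineK//; apply: integrable_fin_num => //.
exact: integrable_cos_kernel.
Qed.

(** The kernel is not integrable on the plane; multiplied by an integrable
    weight in [y] it is, which gives measurability of the weighted transform. *)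
Lemma measurable_cos_transform t : measurable_fun setT (cos_transform t).
Proof.
pose F (z : R * R) :=
  (exp_weight 1 z.1 * g z.2 * cos (2 * pi * z.1 * (z.2 + t)))%:E.
have iF : (mu \x mu)%E.-integrable setT F.
  apply: (integrable_bounded_tensor _ _ 1).
  - exact: integrable_exp_weight.
  - exact: measurable_cos_kernel.
  - by move=> z; exact: normr_cos_le1.
have /= mF := measurable_fubini_F iF.
have {}mF : measurable_fun setT (fun y => exp_weight 1 y * cos_transform t y).
  apply/measurable_EFinP; apply: eq_measurable_fun mF => y _.
  rewrite /= /fubini_F EFinM EFin_cos_transform -integralZl//.
    by apply: eq_integral => x _; rewrite /F /= -EFinM; congr EFin; ring.
  exact: integrable_cos_kernel.
rewrite (_ : cos_transform t =
    fun y => expR `|y| * (exp_weight 1 y * cos_transform t y)).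
  apply: measurable_funM => //.
  by apply: measurableT_comp => //; exact: measurable_expR.
by apply/funext => y; rewrite mulrA -expRD mul1r subrr expR0 mul1r.
Qed.

Lemma cos_transform_bound t y : `|cos_transform t y| <= \int[mu]_x g x.
Proof.
apply: (le_trans (le_normr_Rintegral measurableT (integrable_cos_kernel t y))).
apply: le_Rintegral => //.
- by apply: integrable_norm; exact: integrable_cos_kernel.
- by move=> x _; rewrite normrM (ger0_norm (g_ge0 x)) ler_piMl// normr_cos_le1.
Qed.

Lemma integrable_mulr_bounded v (w : R -> R) (B : R) :
  mu.-integrable setT (EFin \o v) -> measurable_fun setT w ->
  (forall y, `|w y| <= B) -> mu.-integrable setT (fun y => (v y * w y)%:E).
Proof.
move=> iv mw wB.
have B0 : 0 <= B by exact: le_trans (wB 0).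
apply: le_integrable (integrableZl measurableT B iv) => //.
  apply/measurable_EFinP; apply: measurable_funM => //.
  by apply/measurable_EFinP; exact: measurable_int iv.
by move=> y _ /=; rewrite lee_fin !normrM mulrC (ger0_norm B0) ler_wpM2r.
Qed.

Lemma measurable_cos_lin u :
  measurable_fun setT (fun y => cos (2 * pi * y * u)).
Proof. by apply: measurable_cos_comp; do 2 apply: measurable_funM => //. Qed.

(** Fubini together with
      2 cos(a) cos(b) = cos(a + b) + cos(a - b):
    one more factor [2 * cos_transform t] under a cosine integral at frequency
    [u] averages that integral over frequencies to both sides of [u]. *)
Lemma integral_cos_transform_split v t u : mu.-integrable setT (EFin \o v) ->
  (\int[mu]_y (v y * (2 * cos_transform t y) * cos (2 * pi * y * u))%:E =
   \int[mu]_x ((g x)%:E *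
     (\int[mu]_y (v y * cos (2 * pi * y * (u + t + x)))%:E +
      \int[mu]_y (v y * cos (2 * pi * y * (u - t - x)))%:E)))%E.
Proof.
move=> iv.
pose k (z : R * R) :=
  2 * cos (2 * pi * z.1 * u) * cos (2 * pi * z.1 * (z.2 + t)).
have iF : (mu \x mu)%E.-integrable setT
    (fun z : R * R => (v z.1 * g z.2 * k z)%:E).
  apply: (integrable_bounded_tensor _ _ 2) => //.
  - apply: measurable_funM; last exact: measurable_cos_kernel.
    apply: measurable_funM => //; apply: measurable_cos_comp.
    by do 2 apply: measurable_funM => //.
  - move=> z; rewrite /k !normrM ger0_norm//.
    rewrite -[leRHS]mulr1 -[X in _ <= _ * X]mulr1 -mulrA ler_wpM2l//.
    by rewrite ler_pM ?normr_cos_le1.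
transitivity (\int[mu]_y \int[mu]_x (v y * g x * k (y, x))%:E)%E.
  apply: eq_integral => y _.
  rewrite (_ : v y * _ * _ =
    (v y * (2 * cos (2 * pi * y * u))) * cos_transform t y); last by ring.
  rewrite EFinM EFin_cos_transform -integralZl//;
    last exact: integrable_cos_kernel.
  by apply: eq_integral => x _; rewrite -EFinM /k/=; congr EFin; ring.
rewrite (Fubini iF); apply: eq_integral => x _.
have ivc (w : R) :
    mu.-integrable setT (fun y => (v y * cos (2 * pi * y * w))%:E).
  apply: (integrable_mulr_bounded _ _ 1) => //; first exact: measurable_cos_lin.
  by move=> y; exact: normr_cos_le1.
rewrite -integralD// -integralZl//; last exact: integrableD.
apply: eq_integral => y _; rewrite -EFinD -EFinM /k/=; congr EFin.
have -> : 2 * pi * y * (u + t + x) = 2 * pi * y * u + 2 * pi * y * (x + t).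
  by ring.
have -> : 2 * pi * y * (u - t - x) = 2 * pi * y * u - 2 * pi * y * (x + t).
  by ring.
by rewrite cosD cosB; ring.
Qed.

Variable eps : R.
Hypothesis eps_gt0 : 0 < eps.

Lemma integral_weighted_power t n u :
  (\int[mu]_y (exp_weight eps y * (2 * cos_transform t y) ^+ n *
               cos (2 * pi * y * u))%:E =
   iter n (split_average g t) (exp_kernel eps) u)%E.
Proof.
have iw m : mu.-integrable setT
    (fun y => (exp_weight eps y * (2 * cos_transform t y) ^+ m)%:E).
  apply: (integrable_mulr_bounded _ _ ((2 * \int[mu]_x g x) ^+ m)).
  - exact: integrable_exp_weight.
  - apply: measurable_funX; apply: measurable_funM => //.
    exact: measurable_cos_transform.
  - move=> y; rewrite normrX lerXn2r ?nnegrE//.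
      by rewrite mulr_ge0// Rintegral_ge0.
    by rewrite normrM ger0_norm// ler_wpM2l// cos_transform_bound.
elim: n u => [|n IH] u.
  rewrite /= /exp_kernel -integral_exp_weight_cos//.
  apply: eq_integral => y _; rewrite expr0 mulr1.
  by congr (_ * cos _)%:E; ring.
have nn : nneg_measurable (iter n (split_average g t) (exp_kernel eps)).
  apply: nneg_measurable_iter; last exact: nneg_measurable_exp_kernel.
  by move=> ? ?; exact: nneg_measurable_split_average.
transitivity (\int[mu]_y
    (exp_weight eps y * (2 * cos_transform t y) ^+ n * (2 * cos_transform t y) *
     cos (2 * pi * y * u))%:E)%E.
  by apply: eq_integral => y _; rewrite exprSr !mulrA.
rewrite integral_cos_transform_split; last exact: iw.
rewrite iterS /split_average /average -ge0_integralD//.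
- apply: eq_integral => x _; rewrite !IH mul1r mulN1r.
  by rewrite ge0_muleDr ?(proj2 nn).
- by move=> x _; exact: average_integrand_ge0.
- exact: measurable_average_integrand1.
- by move=> x _; exact: average_integrand_ge0.
- exact: measurable_average_integrand1.
Qed.

End fourier_side.

(** * The Fourier transform of S_t f and the conclusion *)

Section splitting_transform.
Context {R : realType}.
Local Notation mu := (@lebesgue_measure R).
Implicit Types (t x y : R).
Variable f : R -> R.
Hypotheses (fS : class_S f) (f_even : ae_even f) (f_ge0 : ae_nonneg f).

Let ae_filter := ae_filter_ringOfSetsType mu.

(** A representative of f_+ that is non-negative at every point, and not only
    almost everywhere. *)
Definition half_line_part : R -> R :=
  fun x => `|f x| * \1_[set u : R | 0 < u] x.

Local Notation g := half_line_part.

Lemma integrable_class_S : mu.-integrable setT (EFin \o f).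
Proof. by case: fS => /Lfun1_integrable. Qed.

Lemma measurable_class_S : measurable_fun setT f.
Proof. by apply/measurable_EFinP; exact: measurable_int integrable_class_S. Qed.

Let mpos : measurable_fun setT (\1_[set u : R | 0 < u] : R -> R).
Proof.
by apply: measurable_indic; rewrite -set_itvoy; exact: measurable_itv.
Qed.

Let mneg : measurable_fun setT (\1_[set u : R | u < 0] : R -> R).
Proof.
by apply: measurable_indic; rewrite -set_itvNyo; exact: measurable_itv.
Qed.

Lemma measurable_half_line_part : measurable_fun setT g.
Proof.
apply: measurable_funM => //; apply: measurableT_comp => //.
exact: measurable_class_S.
Qed.

Lemma half_line_part_ge0 x : 0 <= g x.
Proof. by rewrite /g mulr_ge0. Qed.

Lemma half_line_part_eq0 x : x <= 0 -> g x = 0.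
Proof. by move=> x0; rewrite /g indicE memNset ?mulr0//= ltNge x0. Qed.

Lemma half_line_part_pos x : 0 < x -> g x = `|f x|.
Proof. by move=> x0; rewrite /g indicE mem_set// mulr1. Qed.

Lemma integrable_half_line_part : mu.-integrable setT (EFin \o g).
Proof.
apply: le_integrable integrable_class_S => //.
  by apply/measurable_EFinP; exact: measurable_half_line_part.
move=> x _ /=; rewrite lee_fin (ger0_norm (half_line_part_ge0 x)).
have [x0|x0] := leP x 0; first by rewrite half_line_part_eq0.
by rewrite half_line_part_pos.
Qed.

Lemma ae_right_part : {ae mu, forall x, right_part f x = g x}.
Proof.
move: f_ge0; apply: filterS; first exact: ae_filter.
by move=> x fx; rewrite /right_part /g ger0_norm.
Qed.

Lemma ae_left_part : {ae mu, forall x, left_part f x = g (- x)}.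
Proof.
move: f_ge0 f_even; apply: filterS2; first exact: ae_filter.
move=> x fx ex.
rewrite /left_part indicE.
have [x0|x0] := ltP x 0.
  by rewrite mem_set// mulr1 half_line_part_pos ?oppr_gt0// ex ger0_norm.
by rewrite half_line_part_eq0 ?oppr_le0// memNset ?mulr0//= ltNge x0.
Qed.

(** The right-hand side has the shape [F (1 * x + a) + F (-1 * x + a)] to which
    the invariance lemmas apply. *)
Lemma ae_splitting t :
  {ae mu, forall x, splitting t f x = g (1 * x + - t) + g (-1 * x + - t)}.
Proof.
have aR := ae_affine 1 (- t) (fun x => right_part f x = g x) (expr1n _ _)
  ae_right_part.
have aL := ae_affine 1 t (fun x => left_part f x = g (- x)) (expr1n _ _)
  ae_left_part.
move: aR aL; apply: filterS2; first exact: ae_filter.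
move=> x; rewrite !mul1r /splitting => -> ->.
by rewrite mulN1r opprD.
Qed.

Lemma measurable_splitting t : measurable_fun setT (splitting t f).
Proof.
have mf := measurable_class_S.
apply: measurable_funD.
  apply: (@measurableT_comp _ _ _ _ _ _ (right_part f)).
    exact: measurable_funM.
  exact: measurable_funD.
apply: (@measurableT_comp _ _ _ _ _ _ (left_part f)).
  exact: measurable_funM.
exact: measurable_funD.
Qed.

(** The two halves of S_t f are mirror images of each other, so they contribute
    equally to the real part and cancel in the imaginary part. *)
Lemma fourier_splitting t y :
  fourier (splitting t f) y = Complex (2 * cos_transform g t y) 0.
Proof.
have mg := measurable_half_line_part.
have mg' e : measurable_fun setT (fun x => g (e * x + - t)).
  by apply: measurableT_comp => //; exact: measurable_affine.
have mS := measurable_splitting t.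
have one : 1 ^+ 2 = 1 :> R by rewrite expr1n.
have mone : (-1) ^+ 2 = 1 :> R by rewrite sqrrN expr1n.
have ml : measurable_fun setT (fun x : R => 2 * pi * x * y).
  by apply: measurable_funM => //; exact: measurable_funM.
have mcos : measurable_fun setT (fun x : R => cos (- (2 * pi * x * y))).
  by apply: measurable_cos_comp; exact: measurable_funN.
have msin : measurable_fun setT (fun x : R => sin (- (2 * pi * x * y))).
  apply: (measurableT_comp (continuous_measurable_fun (@continuous_sin R))).
  exact: measurable_funN.
rewrite /fourier /Cintegral; congr Complex; rewrite /Rintegral.
- pose F x := (cos (2 * pi * y * (x + t)) * g x)%:E.
  have iF : mu.-integrable setT F.
    by apply: integrable_cos_kernel => //; exact: integrable_half_line_part.
  have mF := measurable_int _ iF.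
  rewrite (_ : (\int[mu]_x _)%E = (2 * cos_transform g t y)%:E)//.
  transitivity (\int[mu]_x (F (1 * x + - t)%R + F (-1 * x + - t)%R))%E.
    apply: ae_eq_integral => //.
    + apply/measurable_EFinP => /=.
      by apply: measurable_funB; exact: measurable_funM.
    + by apply: emeasurable_funD; exact: measurable_comp_affine.
    + move: (ae_splitting t); apply: filterS; first exact: ae_filter.
      move=> x -> _ /=.
      rewrite /F -EFinD mulr0 subr0 cosN; congr EFin.
      rewrite (_ : 2 * pi * y * (1 * x + - t + t) = 2 * pi * x * y);
        last by ring.
      rewrite (_ : 2 * pi * y * (-1 * x + - t + t) = - (2 * pi * x * y));
        last by ring.
      by rewrite cosN mulrDr.
  rewrite integralD//; try exact: integrable_affine.
  rewrite !integral_affine// /F -EFin_cos_transform//.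
  + by rewrite -EFinD; congr EFin; ring.
  + exact: integrable_half_line_part.
- pose H x := (- sin (2 * pi * y * (x + t)) * g x)%:E.
  have iH : mu.-integrable setT H.
    apply: le_integrable integrable_half_line_part => //.
      apply/measurable_EFinP; apply: measurable_funM => //.
      apply: measurable_funN.
      apply: (measurableT_comp (continuous_measurable_fun (@continuous_sin R))).
      by apply: measurable_funM => //; exact: measurable_funD.
    move=> x _ /=; rewrite lee_fin normrM ler_piMl// normrN ler_norml.
    by rewrite sin_geN1 sin_le1.
  have mH := measurable_int _ iH.
  rewrite (_ : (\int[mu]_x _)%E = 0%E)//.
  transitivity (\int[mu]_x (H (1 * x + - t)%R - H (-1 * x + - t)%R))%E.
    apply: ae_eq_integral => //.
    + apply/measurable_EFinP => /=.
      by apply: measurable_funD; exact: measurable_funM.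
    + by apply: emeasurable_funB; exact: measurable_comp_affine.
    + move: (ae_splitting t); apply: filterS; first exact: ae_filter.
      move=> x -> _ /=.
      rewrite /H -EFinB mulr0 add0r; congr EFin.
      rewrite (_ : 2 * pi * y * (1 * x + - t + t) = 2 * pi * x * y);
        last by ring.
      rewrite (_ : 2 * pi * y * (-1 * x + - t + t) = - (2 * pi * x * y));
        last by ring.
      by rewrite !sinN; ring.
  rewrite integralB//; try exact: integrable_affine.
  by rewrite !integral_affine// subee//; exact: integrable_fin_num.
Qed.

(** The integral defining the convolution is finite because
    g(x) g(x + v) <= g(x)^2 + g(x + v)^2; the two sides then differ only by the
    choice of representatives. *)
Lemma correlation_class_S v :
  correlation g v = (convolution (right_part f) (left_part f) (- v))%:E.
Proof.
have mg := measurable_half_line_part.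
have mf := measurable_class_S.
have mgv : measurable_fun setT (fun x => g (x + v)).
  by apply: measurableT_comp => //; exact: measurable_funD.
have ig2 : mu.-integrable setT (fun x => (g x ^+ 2)%:E).
  have /Lfun2_integrable_sqr if2 : f \in Lfun mu 2%:E by case: fS.
  apply: le_integrable if2 => //.
    by apply/measurable_EFinP; exact: measurable_funX.
  move=> x _ /=; rewrite lee_fin !normrX lerXn2r ?nnegrE//.
  rewrite (ger0_norm (half_line_part_ge0 x)).
  have [x0|x0] := leP x 0; first by rewrite half_line_part_eq0.
  by rewrite half_line_part_pos.
have igg : mu.-integrable setT (fun x => (g x * g (x + v))%:E).
  have ig2v := integrable_affine 1 v _ (expr1n _ _) ig2.
  apply: le_integrable (integrableD measurableT ig2 ig2v) => //.
    by apply/measurable_EFinP; exact: measurable_funM.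
  move=> x _ /=.
  rewrite mul1r lee_fin ger0_norm ?mulr_ge0 ?half_line_part_ge0//.
  rewrite ger0_norm ?addr_ge0 ?sqr_ge0//.
  by have := sqr_ge0 (g x - g (x + v)); nra.
rewrite /correlation -[LHS]fineK; last exact: integrable_fin_num.
congr EFin; rewrite /convolution /Rintegral; congr fine.
apply/esym/ae_eq_integral => //.
- apply/measurable_EFinP; apply: measurable_funM; first exact: measurable_funM.
  apply: (@measurableT_comp _ _ _ _ _ _ (left_part f)).
    exact: measurable_funM.
  exact: measurable_funB.
- exact: measurable_int igg.
- have aL := ae_affine (-1) (- v) (fun x => left_part f x = g (- x))
    (etrans (sqrrN 1) (expr1n _ _)) ae_left_part.
  move: ae_right_part aL; apply: filterS2; first exact: ae_filter.
  move=> x -> + _.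
  by rewrite mulN1r addrC => ->; rewrite opprD !opprK addrC.
Qed.

Lemma sym_decreasing_correlation : sym_decreasing (correlation g).
Proof.
have even v : correlation g (- v) = correlation g v.
  rewrite /correlation.
  rewrite -[RHS](@ge0_integral_affine _ 1 (- v)) ?expr1n//.
  - by apply: eq_integral => x _; rewrite mul1r subrK mulrC.
  - apply/measurable_EFinP; apply: measurable_funM.
      exact: measurable_half_line_part.
    apply: measurableT_comp; first exact: measurable_half_line_part.
    exact: measurable_funD.
  - by move=> x; rewrite lee_fin mulr_ge0 ?half_line_part_ge0.
have norm v : correlation g v = correlation g (- `|v|).
  by rewrite even; have [v0|v0] := ger0P v; rewrite ?even.
move=> x y xy; rewrite (norm x) (norm y) !correlation_class_S !opprK lee_fin.
by case: fS => _ _; apply.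
Qed.

Lemma split_normE (p : nat) t : (0 < p)%N -> ~~ odd p ->
  split_norm p t f =
  ((\int[mu]_y ((2 * cos_transform g t y) ^+ p)%:E) `^ (p%:R^-1))%E.
Proof.
move=> p0 podd; rewrite /split_norm /CLnorm unlock; congr (_ `^ _)%E.
apply: eq_integral => y _; rewrite fourier_splitting /=.
rewrite expr0n/= addr0 sqrtr_sqr normr_id powR_mulrn// -normrX ger0_norm//.
by rewrite exprn_even_ge0.
Qed.

(** With the weight, the two integrals are iterated averages of the same kernel
    at the point 0 and compare for every [eps]; the weight increases to 1 along
    [eps = 1 / (n + 1)]. *)
Lemma integral_power_decr (p : nat) s t : ~~ odd p -> 0 <= s -> s <= t ->
  (\int[mu]_y ((2 * cos_transform g t y) ^+ p)%:E <=
   \int[mu]_y ((2 * cos_transform g s y) ^+ p)%:E)%E.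
Proof.
move=> podd s0 st.
have mg := measurable_half_line_part.
have g0 := half_line_part_ge0.
have ig := integrable_half_line_part.
have mD r : measurable_fun setT (fun y => (2 * cos_transform g r y) ^+ p).
  apply: measurable_funX; apply: measurable_funM => //.
  exact: measurable_cos_transform.
have D0 r y : 0 <= (2 * cos_transform g r y) ^+ p by exact: exprn_even_ge0.
have mW eps : measurable_fun setT (@exp_weight R eps).
  exact: continuous_measurable_fun (continuous_exp_weight eps).
have weighted eps : 0 < eps ->
    (\int[mu]_y (exp_weight eps y * (2 * cos_transform g t y) ^+ p)%:E <=
     \int[mu]_y ((2 * cos_transform g s y) ^+ p)%:E)%E.
  move=> eps0.
  apply: (@le_trans _ _
      (\int[mu]_y (exp_weight eps y * (2 * cos_transform g s y) ^+ p)%:E)%E).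
    have E r :
        (\int[mu]_y (exp_weight eps y * (2 * cos_transform g r y) ^+ p)%:E =
         iter p (split_average g r) (exp_kernel eps) (1 * (0%:R * r))%R)%E.
      rewrite mul0r mulr0 -integral_weighted_power//.
      by apply: eq_integral => y _; rewrite mulr0 cos0 mulr1.
    rewrite !E.
    apply: (iter_split_average_decr _ _ _ _ _ p 1 0 (exp_kernel eps)) => //.
    - exact: half_line_part_eq0.
    - exact: sym_decreasing_correlation.
    - by left.
    - exact: nneg_measurable_exp_kernel.
    - exact: sym_decreasing_exp_kernel.
  apply: ge0_le_integral => //.
  - move=> y _; rewrite lee_fin; apply: mulr_ge0; last exact: D0.
    exact: exp_weight_ge0.
  - by apply/measurable_EFinP; exact: measurable_funM (mW eps) (mD s).
  - by apply/measurable_EFinP; exact: mD.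
  - move=> y _; rewrite lee_fin; apply: ler_piMl; first exact: D0.
    rewrite /exp_weight -[leRHS]expR0 ler_expR.
    by rewrite oppr_le0 mulr_ge0// ltW.
pose G n y := (exp_weight n.+1%:R^-1 y * (2 * cos_transform g t y) ^+ p)%:E.
have mG n : measurable_fun setT (G n).
  by apply/measurable_EFinP; exact: measurable_funM (mW _) (mD t).
have G0 n y : setT y -> (0 <= G n y)%E.
  by move=> _; rewrite lee_fin mulr_ge0 ?exp_weight_ge0.
have ndG y : setT y -> nondecreasing_seq (G ^~ y).
  move=> _ m n mn; rewrite lee_fin ler_wpM2r// ler_expR lerN2 ler_wpM2r//.
  by rewrite lef_pV2 ?posrE// ler_nat.
have cG y : G n y @[n --> \oo] --> ((2 * cos_transform g t y) ^+ p)%:E.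
  apply/cvg_EFin; first exact: nearW.
  rewrite -[X in _ --> X]mul1r; apply: cvgM; last exact: cvg_cst.
  rewrite [X in _ --> X](_ : _ = expR (- (0 * `|y|))); last first.
    by rewrite mul0r oppr0 expR0.
  apply: continuous_cvg; first exact: continuous_expR.
  by apply: cvgN; apply: cvgM; [exact: cvg_harmonic|exact: cvg_cst].
rewrite (_ : (\int[mu]_y ((2 * cos_transform g t y) ^+ p)%:E)%E =
             (\int[mu]_y limn (G ^~ y))%E); last first.
  by apply: eq_integral => y _; apply/esym/cvg_lim => //; exact: cG.
rewrite monotone_convergence//; apply: lime_le.
  apply: ereal_nondecreasing_is_cvgn => m n mn.
  apply: ge0_le_integral; first exact: measurableT.
  - by move=> y; exact: G0.
  - exact: mG.
  - exact: mG.
  - by move=> y yT; exact: ndG.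
by apply: nearW => n; exact: weighted.
Qed.

End splitting_transform.

Theorem theorem1p1 (R : realType) (p : nat) (p_ge2 : (2 <= p)%N)
    (p_even : ~~ odd p) (f : R -> R) (fS : class_S f) (f_even : ae_even f)
    (f_ge0 : ae_nonneg f) :
  (forall s t : R, 0 <= s -> s <= t ->
     (split_norm p t f <= split_norm p s f)%E) /\
  (forall t : R, 0 <= t -> (split_norm p t f <= split_norm p 0 f)%E).
Proof.
have decr (s t : R) : 0 <= s -> s <= t ->
    (split_norm p t f <= split_norm p s f)%E.
  move=> s0 st; have p0 : (0 < p)%N by exact: leq_trans p_ge2.
  have I0 r : (0 <= \int[lebesgue_measure]_y
      ((2 * cos_transform (half_line_part f) r y) ^+ p)%:E)%E.
    by apply: integral_ge0 => y _; rewrite lee_fin exprn_even_ge0.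
  rewrite !split_normE//; apply: gt0_ler_poweR.
  - by rewrite invr_ge0.
  - by rewrite in_itv/= leey I0.
  - by rewrite in_itv/= leey I0.
  - exact: integral_power_decr.
by split => // t t0; exact: decr.
Qed.
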